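(* Suppose that the solution set $T^{-1}(0)$ of the variational inequality $T(x)=F(x)+N(x)\ni0$ is empty (the quadratic program (QP) is primal-dual infeasible). Let $x_0\in\mathbb{R}^l$ be arbitrary, let the sequence of iterates $\{x_k\}=\{(z_k,\lambda_k,v_k)\}$ be generated by the FBstab algorithm (described in the context) with constant regularization parameter $\sigma>0$, and define $\delta x_k=x_{k+1}-x_k$. Then $\delta x_k\to\delta x$ as $k\to\infty$ for some $\delta x=(\delta z,\delta\lambda,\delta v)\in\mathbb{R}^l$ which satisfies the following properties: (i) If $\delta z\ne0$ then the dual QP (D) is infeasible and $\delta z$ satisfies the dual infeasibility conditions $H\delta z=0$, $A\delta z\le0$, $G\delta z=0$, $f^T\delta z<0$. (ii) If $(\delta\lambda,\delta v)\ne0$ then the primal QP (QP) is infeasible and $(\delta\lambda,\delta v)$ satisfies the primal infeasibility conditions $G^T\delta\lambda+A^T\delta v=0$ and $\delta\lambda^Th+(\delta v)_+^Tb<0$, where $(\delta v)_+$ is the projection of $\delta v$ onto the nonnegative orthant. (iii) If $\delta z\ne0$ and $(\delta\lambda,\delta v)\ne0$ then both (QP) and (D) are infeasible.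
   Context: Problem (QP): the convex quadratic program $\min_z \frac12 z^THz+f^Tz$ subject to $Gz=h$, $Az\le b$, where $H=H^T\succeq0\in\mathbb{R}^{n\times n}$, $f\in\mathbb{R}^n$, $G\in\mathbb{R}^{m\times n}$, $h\in\mathbb{R}^m$, $A\in\mathbb{R}^{q\times n}$, $b\in\mathbb{R}^q$; no other assumptions on the data. Its dual (D): $\min_{u,\lambda,v}\frac12u^THu+b^Tv+h^T\lambda$ subject to $Hu+f+G^T\lambda+A^Tv=0$, $v\ge0$. A problem is infeasible if its feasible set is empty. Write $x=(z,\lambda,v)\in\mathbb{R}^n\times\mathbb{R}^m\times\mathbb{R}^q=\mathbb{R}^l$, $l=n+m+q$. The KKT conditions are equivalent to $T(x)=F(x)+N(x)\ni0$, where $$F(x)=Kx+w,\quad K=\begin{bmatrix}H&G^T&A^T\\-G&0&0\\-A&0&0\end{bmatrix},\quad w=\begin{bmatrix}f\\ h\\ b\end{bmatrix},$$ and $N(x)$ is the normal cone at $x$ of $C=\mathbb{R}^n\times\mathbb{R}^m\times\mathbb{R}^q_{\ge0}$: $N(x)=\{w'\mid\langle x-u,w'\rangle\ge0\ \forall u\in C\}$ if $x\in C$, and $N(x)=\emptyset$ otherwise. $T^{-1}(0)=\{x\mid 0\in T(x)\}$. $\|\cdot\|$ is the Euclidean norm. Natural residual: $\pi(x)=x-\Pi_C(x-F(x))$, $\Pi_C$ the Euclidean projection onto $C$. Penalized Fischer-Burmeister function: for fixed $\alpha\in(0,1)$, $\phi(a,b)=\alpha(a+b-\sqrt{a^2+b^2})+(1-\alpha)a_+b_+$,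 where $a_+=\max(a,0)$. For $\bar x=(\bar z,\bar\lambda,\bar v)\in\mathbb{R}^l$, $\sigma>0$, set $$R(x,\bar x,\sigma)=\begin{bmatrix}Hz+f+G^T\lambda+A^Tv+\sigma(z-\bar z)\\ h-Gz+\sigma(\lambda-\bar\lambda)\\ \phi(y,v)\end{bmatrix},\quad y=b-Az+\sigma(v-\bar v),$$ with $\phi$ applied elementwise, and $\theta(x)=\frac12\|R(x,\bar x,\sigma)\|^2$. The C-subdifferential of $R(\cdot,\bar x,\sigma)$ at $x$ is $\bar\partial R=\partial R_1\times\dots\times\partial R_l$ (matrices whose $i$-th row belongs to the Clarke generalized gradient of the $i$-th component in $x$). Procedure EvalProx$(\bar x,\varepsilon,\sigma)$, with fixed parameters $\beta\in(0,1)$, $\eta\in(0,0.5)$: start from $x=\bar x$; repeat: pick any $V\in\bar\partial R(x,\bar x,\sigma)$, solve $V\Delta x=-R(x,\bar x,\sigma)$, set $t=1$, and while $\theta(x+t\Delta x)\ge\theta(x)+\eta t\nabla\theta(x)^T\Delta x$ replace $t$ by $\beta t$; then set $x\leftarrow x+t\Delta x$; until $\|R(x,\bar x,\sigma)\|\le\varepsilon\min\{1,\|x-\bar x\|\}$. Return $x$. If a root of $R(\cdot,\bar x,\sigma)$ is reached, that root is returned. FBstab (outer loop), with parameters $\kappa\in(0,1)$, $\sigma>0$ and initial point $x_0$: set $\epsilon=\epsilon_0=\|\pi(x_0)\|$ and $\delta=\min(\epsilon_0/\sigma,1)$. For $k=0,1,2,\dots$: set $\delta\leftarrow\min(\kappa\delta,\epsilon/\delta)$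 (this value is $\delta_k$), $x_{k+1}=$ EvalProx$(x_k,\delta_k\sigma,\sigma)$, $\epsilon\leftarrow\|\pi(x_{k+1})\|$. The sequence $\{x_k\}$ is the infinite sequence obtained when the outer termination tolerances and the infeasibility test are disregarded. *)

(* Defs.v *)
(* Vectors are columns 'cV[R]_k, and R^l is 'cV[R]_(n + (m + q)),
   so that x = (z, lambda, v) is col_mx z (col_mx lambda v). *)
From HB Require Import structures.
From mathcomp Require Import all_boot all_order all_algebra.
From mathcomp Require Import all_classical all_reals all_analysis.

Set Implicit Arguments.
Unset Strict Implicit.
Unset Printing Implicit Defensive.

Import Order.TTheory GRing.Theory Num.Theory.
Import numFieldNormedType.Exports.

Local Open Scope classical_set_scope.
Local Open Scope ring_scope.

Definition dot (R : realType) (k : nat) (u w : 'cV[R]_k) : R := (u^T *m w) 0 0.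

(* The library norm `|u| of a column is the sup norm; [enorm] is Euclidean. *)
Definition enorm (R : realType) (k : nat) (u : 'cV[R]_k) : R :=
  Num.sqrt (dot u u).

Definition vle (R : realType) (k : nat) (u w : 'cV[R]_k) : Prop :=
  forall i, u i 0 <= w i 0.

Definition nonneg_orthant (R : realType) (k : nat) : set 'cV[R]_k :=
  [set v | vle 0 v].

(* Nearest point of [S] to [x]; the default value [x] is irrelevant for a
   nonempty closed convex [S], where the minimizer exists and is unique. *)
Definition eproj (R : realType) (k : nat) (S : set 'cV[R]_k) (x : 'cV[R]_k) :
    'cV[R]_k :=
  xget x [set p | S p /\ forall u, S u -> enorm (x - p) <= enorm (x - u)].

(* Empty when [x] is not in [S]. *)
Definition normal_cone (R : realType) (k : nat) (S : set 'cV[R]_k)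
    (x : 'cV[R]_k) : set 'cV[R]_k :=
  [set p | S x /\ forall u, S u -> 0 <= dot (x - u) p].

Definition symmetric_psd (R : realType) (k : nat) (M : 'M[R]_k) : Prop :=
  M^T = M /\ forall z : 'cV[R]_k, 0 <= dot z (M *m z).

(* Meaningful only where [f] is differentiable. *)
Definition grad (R : realType) (k : nat) (f : 'cV[R]_k -> R) (x : 'cV[R]_k) :
    'cV[R]_k :=
  \col_i 'd f x (delta_mx i 0).

(* Clarke generalized gradient of a locally Lipschitz [f]: the convex hull of
   the limits of gradients of [f] along sequences of points of
   differentiability converging to [x]. *)
Definition clarke_gradient (R : realType) (k : nat) (f : 'cV[R]_k -> R)
    (x : 'cV[R]_k) : set 'cV[R]_k :=
  smallest (@convex_set R 'cV[R]_k)
    [set g | exists y : nat -> 'cV[R]_k,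
       [/\ forall j, differentiable f (y j),
           y j @[j --> \oo] --> x
         & grad f (y j) @[j --> \oo] --> g]].

Definition C_subdifferential (R : realType) (k l : nat)
    (Phi : 'cV[R]_k -> 'cV[R]_l) (x : 'cV[R]_k) : set 'M[R]_(l, k) :=
  [set V | forall i, clarke_gradient (fun y => Phi y i 0) x (row i V)^T].

(* min (1/2) z^T H z + f^T z  subject to  G z = h, A z <= b *)
Record qp_data (R : realType) (n m q : nat) := QPData {
  qpH : 'M[R]_n;
  qpf : 'cV[R]_n;
  qpG : 'M[R]_(m, n);
  qph : 'cV[R]_m;
  qpA : 'M[R]_(q, n);
  qpb : 'cV[R]_q }.

Definition primal_feasible (R : realType) (n m q : nat) (P : qp_data R n m q) :
    set 'cV[R]_n :=
  [set z | qpG P *m z = qph P /\ vle (qpA P *m z) (qpb P)].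

Definition dual_feasible (R : realType) (n m q : nat) (P : qp_data R n m q) :
    set ('cV[R]_n * 'cV[R]_m * 'cV[R]_q) :=
  [set p | let: (u, lam, v) := p in
     qpH P *m u + qpf P + (qpG P)^T *m lam + (qpA P)^T *m v = 0 /\ vle 0 v].

Definition primal_infeasible (R : realType) (n m q : nat)
    (P : qp_data R n m q) : Prop := primal_feasible P = set0.

Definition dual_infeasible (R : realType) (n m q : nat)
    (P : qp_data R n m q) : Prop := dual_feasible P = set0.

Definition zpart (R : realType) (n m q : nat) (x : 'cV[R]_(n + (m + q))) :
    'cV[R]_n := usubmx x.
Definition lpart (R : realType) (n m q : nat) (x : 'cV[R]_(n + (m + q))) :
    'cV[R]_m := usubmx (dsubmx x).
Definition vpart (R : realType) (n m q : nat) (x : 'cV[R]_(n + (m + q))) :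
    'cV[R]_q := dsubmx (dsubmx x).

Definition coneC (R : realType) (n m q : nat) : set 'cV[R]_(n + (m + q)) :=
  [set x | nonneg_orthant (vpart x)].

Definition KKT_mx (R : realType) (n m q : nat) (P : qp_data R n m q) :
    'M[R]_(n + (m + q)) :=
  block_mx (qpH P) (row_mx (qpG P)^T (qpA P)^T) (col_mx (- qpG P) (- qpA P)) 0.

Definition KKT_vec (R : realType) (n m q : nat) (P : qp_data R n m q) :
    'cV[R]_(n + (m + q)) :=
  col_mx (qpf P) (col_mx (qph P) (qpb P)).

Definition Fmap (R : realType) (n m q : nat) (P : qp_data R n m q)
    (x : 'cV[R]_(n + (m + q))) : 'cV[R]_(n + (m + q)) :=
  KKT_mx P *m x + KKT_vec P.

Definition Tmap (R : realType) (n m q : nat) (P : qp_data R n m q)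
    (x : 'cV[R]_(n + (m + q))) : set 'cV[R]_(n + (m + q)) :=
  [set Fmap P x + p | p in normal_cone (@coneC R n m q) x].

Definition Tzeros (R : realType) (n m q : nat) (P : qp_data R n m q) :
    set 'cV[R]_(n + (m + q)) :=
  [set x | Tmap P x 0].

Definition natural_residual (R : realType) (n m q : nat) (P : qp_data R n m q)
    (x : 'cV[R]_(n + (m + q))) : 'cV[R]_(n + (m + q)) :=
  x - eproj (@coneC R n m q) (x - Fmap P x).

Definition pfb (R : realType) (alpha a b : R) : R :=
  alpha * (a + b - Num.sqrt (a ^+ 2 + b ^+ 2))
  + (1 - alpha) * (Num.max a 0 * Num.max b 0).

Definition Rmap (R : realType) (n m q : nat) (P : qp_data R n m q)
    (alpha sigma : R) (xbar x : 'cV[R]_(n + (m + q))) :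
    'cV[R]_(n + (m + q)) :=
  let y := qpb P - qpA P *m zpart x + sigma *: (vpart x - vpart xbar) in
  col_mx (qpH P *m zpart x + qpf P + (qpG P)^T *m lpart x
            + (qpA P)^T *m vpart x + sigma *: (zpart x - zpart xbar))
    (col_mx (qph P - qpG P *m zpart x + sigma *: (lpart x - lpart xbar))
       (\col_i pfb alpha (y i 0) (vpart x i 0))).

Definition theta (R : realType) (n m q : nat) (P : qp_data R n m q)
    (alpha sigma : R) (xbar x : 'cV[R]_(n + (m + q))) : R :=
  2^-1 * enorm (Rmap P alpha sigma xbar x) ^+ 2.

Definition sufficient_decrease (R : realType) (n m q : nat)
    (P : qp_data R n m q) (alpha eta sigma : R)
    (xbar x d : 'cV[R]_(n + (m + q))) (t : R) : Prop :=
  theta P alpha sigma xbar (x + t *: d)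
    < theta P alpha sigma xbar x
      + eta * t * dot (grad (theta P alpha sigma xbar) x) d.

(* One pass through the loop body.  The step length is the first of
   1, beta, beta^2, ... at which the backtracking test stops.  [V] is an
   arbitrary element of the C-subdifferential, hence a relation. *)
Definition newton_step (R : realType) (n m q : nat) (P : qp_data R n m q)
    (alpha beta eta sigma : R) (xbar x x' : 'cV[R]_(n + (m + q))) : Prop :=
  exists V d j,
    [/\ C_subdifferential (Rmap P alpha sigma xbar) x V,
        V *m d = - Rmap P alpha sigma xbar x,
        sufficient_decrease P alpha eta sigma xbar x d (beta ^+ j),
        forall i, (i < j)%N ->
          ~ sufficient_decrease P alpha eta sigma xbar x d (beta ^+ i)
      & x' = x + beta ^+ j *: d].

Definition prox_stop (R : realType) (n m q : nat) (P : qp_data R n m q)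
    (alpha eps sigma : R) (xbar x : 'cV[R]_(n + (m + q))) : Prop :=
  enorm (Rmap P alpha sigma xbar x) <= eps * Num.min 1 (enorm (x - xbar)).

(* [prox_run ... xbar x r]: the loop of EvalProx with center [xbar], entered at
   the current point [x], returns [r].  The stopping test is evaluated after
   each pass, and a root of the residual is returned as soon as it is reached. *)
Inductive prox_run (R : realType) (n m q : nat) (P : qp_data R n m q)
    (alpha beta eta eps sigma : R) (xbar : 'cV[R]_(n + (m + q))) :
    'cV[R]_(n + (m + q)) -> 'cV[R]_(n + (m + q)) -> Prop :=
| prox_run_root x of Rmap P alpha sigma xbar x = 0 :
    prox_run P alpha beta eta eps sigma xbar x x
| prox_run_stop x x' of
    Rmap P alpha sigma xbar x <> 0 &
    newton_step P alpha beta eta sigma xbar x x' &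
    prox_stop P alpha eps sigma xbar x' :
    prox_run P alpha beta eta eps sigma xbar x x'
| prox_run_next x x' r of
    Rmap P alpha sigma xbar x <> 0 &
    newton_step P alpha beta eta sigma xbar x x' &
    ~ prox_stop P alpha eps sigma xbar x' &
    prox_run P alpha beta eta eps sigma xbar x' r :
    prox_run P alpha beta eta eps sigma xbar x r.

Definition eval_prox (R : realType) (n m q : nat) (P : qp_data R n m q)
    (alpha beta eta : R) (xbar : 'cV[R]_(n + (m + q))) (eps sigma : R)
    (r : 'cV[R]_(n + (m + q))) : Prop :=
  prox_run P alpha beta eta eps sigma xbar xbar r.

(* delta_k, as determined by the iterates x 0, ..., x k. *)
Fixpoint fbstab_delta (R : realType) (n m q : nat) (P : qp_data R n m q)
    (kappa sigma : R) (x : nat -> 'cV[R]_(n + (m + q))) (k : nat) : R :=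
  let eps := enorm (natural_residual P (x k)) in
  let delta := if k is k'.+1 then fbstab_delta P kappa sigma x k'
               else Num.min (eps / sigma) 1 in
  Num.min (kappa * delta) (eps / delta).

Definition fbstab_sequence (R : realType) (n m q : nat) (P : qp_data R n m q)
    (alpha beta eta kappa sigma : R) (x0 : 'cV[R]_(n + (m + q)))
    (x : nat -> 'cV[R]_(n + (m + q))) : Prop :=
  x 0%N = x0 /\
  forall k, eval_prox P alpha beta eta (x k)
              (fbstab_delta P kappa sigma x k * sigma) sigma (x k.+1).

Definition dual_infeasibility_conditions (R : realType) (n m q : nat)
    (P : qp_data R n m q) (dz : 'cV[R]_n) : Prop :=
  [/\ qpH P *m dz = 0, vle (qpA P *m dz) 0, qpG P *m dz = 0
    & dot (qpf P) dz < 0].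

Definition primal_infeasibility_conditions (R : realType) (n m q : nat)
    (P : qp_data R n m q) (dl : 'cV[R]_m) (dv : 'cV[R]_q) : Prop :=
  (qpG P)^T *m dl + (qpA P)^T *m dv = 0 /\
  dot dl (qph P) + dot (eproj (@nonneg_orthant R q) dv) (qpb P) < 0.

(* Main.v *)
(* The regularised residual vanishes exactly at the resolvent of the maximal
   monotone operator T, and the error bound |min(a, b)| <= (2/alpha) |phi(a, b)|
   turns the stopping test into a proximal point step with summable errors.
   Let d be the least-norm point of the closure of the range of T.  Exact
   proximal trajectories u_k started at points with T-values close to d keep
   sigma (u_k - u_(k+1)) close to d, and firm nonexpansiveness makes the
   differences of the iterates asymptotic to those of u_k; hence
   x_(k+1) - x_k converges to dx = - d / sigma.
   Minimality gives <dx, w> <= - sigma |dx|^2 for every w in the range of T,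
   which along recession directions yields the homogeneous conditions on dx.
   Passing to the limit in T-values tending to d bounds f^T dz from below by
   - sigma |dz|^2 and the dual product by - sigma |(dl, dv)|^2; at x = 0
   minimality bounds their sum from above, so both bounds are equalities. *)
Require Import Defs.
From mathcomp Require Import all_boot all_order all_algebra.
From mathcomp Require Import all_classical all_reals all_analysis.
From mathcomp Require Import ring lra.

Import Order.TTheory GRing.Theory Num.Theory.
Import numFieldNormedType.Exports.

Local Open Scope classical_set_scope.
Local Open Scope ring_scope.

(** * Euclidean norm *)

Lemma dotE {R : realType} {k : nat} (u w : 'cV[R]_k) :
  dot u w = \sum_i u i 0 * w i 0.
Proof. by rewrite /dot mxE; apply: eq_bigr => i _; rewrite mxE. Qed.

Lemma dotC {R : realType} {k : nat} (u w : 'cV[R]_k) : dot u w = dot w u.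
Proof. by rewrite !dotE; apply: eq_bigr => i _; rewrite mulrC. Qed.

Lemma dotDr {R : realType} {k : nat} (u v w : 'cV[R]_k) :
  dot u (v + w) = dot u v + dot u w.
Proof. by rewrite /dot mulmxDr mxE. Qed.

Lemma dotDl {R : realType} {k : nat} (u v w : 'cV[R]_k) :
  dot (v + w) u = dot v u + dot w u.
Proof. by rewrite !(dotC _ u) dotDr. Qed.

Lemma dotZr {R : realType} {k : nat} (a : R) (u v : 'cV[R]_k) :
  dot u (a *: v) = a * dot u v.
Proof. by rewrite /dot -scalemxAr mxE. Qed.

Lemma dotZl {R : realType} {k : nat} (a : R) (u v : 'cV[R]_k) :
  dot (a *: v) u = a * dot v u.
Proof. by rewrite !(dotC _ u) dotZr. Qed.

Lemma dotNr {R : realType} {k : nat} (u v : 'cV[R]_k) :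
  dot u (- v) = - dot u v.
Proof. by rewrite -scaleN1r dotZr mulN1r. Qed.

Lemma dotNl {R : realType} {k : nat} (u v : 'cV[R]_k) :
  dot (- v) u = - dot v u.
Proof. by rewrite !(dotC _ u) dotNr. Qed.

Lemma dot0r {R : realType} {k : nat} (u : 'cV[R]_k) : dot u 0 = 0.
Proof. by rewrite /dot mulmx0 mxE. Qed.

Lemma dot0l {R : realType} {k : nat} (u : 'cV[R]_k) : dot 0 u = 0.
Proof. by rewrite dotC dot0r. Qed.

Definition dot_linE {R : realType} {k : nat} :=
  (@dotDr R k, @dotDl R k, @dotNr R k, @dotNl R k, @dotZr R k, @dotZl R k,
   @dot0r R k, @dot0l R k).

Lemma dot_sqrB {R : realType} {k : nat} (u v : 'cV[R]_k) :
  dot (u - v) (u - v) = dot u u - 2 * dot u v + dot v v.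
Proof. by rewrite !dot_linE (dotC v u); ring. Qed.

Lemma dot_ge0 {R : realType} {k : nat} (u : 'cV[R]_k) : 0 <= dot u u.
Proof. by rewrite dotE sumr_ge0// => i _; rewrite -expr2 sqr_ge0. Qed.

Lemma dot_eq0 {R : realType} {k : nat} (u : 'cV[R]_k) : dot u u = 0 -> u = 0.
Proof.
rewrite dotE => /eqP; rewrite psumr_eq0 => [/allP u0|i _].
  apply/colP => i; have := u0 i (mem_index_enum i).
  by rewrite mxE mulf_eq0 orbb => /eqP.
by rewrite -expr2 sqr_ge0.
Qed.

Lemma dot_gt0 {R : realType} {k : nat} (u : 'cV[R]_k) :
  u != 0 -> 0 < dot u u.
Proof.
rewrite lt0r dot_ge0 andbT; apply: contra_neq; exact: dot_eq0.
Qed.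

Lemma dot_mulmx {R : realType} {k l : nat} (u : 'cV[R]_k) (M : 'M[R]_(k, l))
  (w : 'cV[R]_l) : dot u (M *m w) = dot (M^T *m u) w.
Proof. by rewrite /dot trmx_mul trmxK mulmxA. Qed.

Lemma dot_col_mx {R : realType} {k l : nat} (a c : 'cV[R]_k) (b d : 'cV[R]_l) :
  dot (col_mx a b) (col_mx c d) = dot a c + dot b d.
Proof. by rewrite /dot tr_col_mx mul_row_col mxE. Qed.

Lemma dot_delta {R : realType} {k : nat} (u : 'cV[R]_k) i :
  dot u (delta_mx i 0) = u i 0.
Proof. by rewrite /dot -colE !mxE. Qed.

Lemma dot_ge0_vle {R : realType} {k : nat} (u v : 'cV[R]_k) :
  vle 0 u -> vle 0 v -> 0 <= dot u v.
Proof.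
move=> u0 v0; rewrite dotE sumr_ge0 // => i _.
by have := v0 i; have := u0 i; rewrite !mxE; exact: mulr_ge0.
Qed.

Lemma vle_subr_ge0 {R : realType} {k : nat} (u v : 'cV[R]_k) :
  vle u v -> vle 0 (v - u).
Proof. by move=> uv i; rewrite !mxE subr_ge0. Qed.

Lemma vle_oppr_ge0 {R : realType} {k : nat} (u : 'cV[R]_k) :
  vle u 0 -> vle 0 (- u).
Proof. by move=> /vle_subr_ge0; rewrite sub0r. Qed.

Lemma vle_addr_ge0 {R : realType} {k : nat} (u v : 'cV[R]_k) :
  vle 0 u -> vle 0 v -> vle 0 (u + v).
Proof.
by move=> u0 v0 i; have := v0 i; have := u0 i; rewrite !mxE; exact: addr_ge0.
Qed.

(** Cauchy-Schwarz: expand the nonnegative square of [dot v v *: u - dot u v *: v] and cancel one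
    factor [dot v v]. *)
Lemma dot_sqr_le {R : realType} {k : nat} (u v : 'cV[R]_k) :
  dot u v ^+ 2 <= dot u u * dot v v.
Proof.
have [->|v0] := eqVneq v 0; first by rewrite !dot0r expr0n mulr0.
have vv := dot_gt0 v v0.
have := dot_ge0 (dot v v *: u - dot u v *: v).
rewrite !dot_linE (dotC v u) => h.
have {}h : 0 <= dot v v * (dot u u * dot v v - dot u v ^+ 2).
  by apply: le_trans h _; rewrite le_eqVlt; apply/orP; left; apply/eqP; ring.
by rewrite -subr_ge0 -(pmulr_rge0 _ vv).
Qed.

Lemma enorm_ge0 {R : realType} {k : nat} (u : 'cV[R]_k) : 0 <= enorm u.
Proof. exact: sqrtr_ge0. Qed.

Lemma enorm_sqr {R : realType} {k : nat} (u : 'cV[R]_k) :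
  enorm u ^+ 2 = dot u u.
Proof. by rewrite sqr_sqrtr// dot_ge0. Qed.

Lemma enorm0 {R : realType} {k : nat} : enorm (0 : 'cV[R]_k) = 0.
Proof. by rewrite /enorm dot0l sqrtr0. Qed.

Lemma enorm_eq0 {R : realType} {k : nat} (u : 'cV[R]_k) : enorm u <= 0 -> u = 0.
Proof.
move=> u0; apply: dot_eq0; rewrite -enorm_sqr.
have -> : enorm u = 0 by apply/le_anti; rewrite u0 enorm_ge0.
by rewrite expr0n.
Qed.

Lemma enormZ {R : realType} {k : nat} (a : R) (u : 'cV[R]_k) :
  enorm (a *: u) = `|a| * enorm u.
Proof.
by rewrite /enorm !dot_linE mulrA -expr2 sqrtrM ?sqr_ge0// sqrtr_sqr.
Qed.

Lemma enormN {R : realType} {k : nat} (u : 'cV[R]_k) : enorm (- u) = enorm u.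
Proof. by rewrite -scaleN1r enormZ normrN1 mul1r. Qed.

Lemma enormBC {R : realType} {k : nat} (u v : 'cV[R]_k) :
  enorm (u - v) = enorm (v - u).
Proof. by rewrite -enormN opprB. Qed.

Lemma dot_le_enorm {R : realType} {k : nat} (u v : 'cV[R]_k) :
  dot u v <= enorm u * enorm v.
Proof.
rewrite /enorm -sqrtrM ?dot_ge0//; apply: le_trans (ler_norm _) _.
by rewrite -sqrtr_sqr ler_sqrt ?dot_sqr_le// mulr_ge0 ?dot_ge0.
Qed.

Lemma normr_dot_le {R : realType} {k : nat} (u v : 'cV[R]_k) :
  `|dot u v| <= enorm u * enorm v.
Proof.
by rewrite ler_norml dot_le_enorm lerNl -dotNl -(enormN u) dot_le_enorm.
Qed.

Lemma enormD {R : realType} {k : nat} (u v : 'cV[R]_k) :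
  enorm (u + v) <= enorm u + enorm v.
Proof.
rewrite -(ler_pXn2r (n := 2))// ?nnegrE ?addr_ge0 ?enorm_ge0//.
rewrite enorm_sqr !dot_linE sqrrD !enorm_sqr (dotC v u).
by have := dot_le_enorm u v; lra.
Qed.

Lemma enorm_le_sqr {R : realType} {k : nat} (u : 'cV[R]_k) (c : R) :
  0 <= c -> dot u u <= c ^+ 2 -> enorm u <= c.
Proof.
by move=> c0 uc; rewrite -(ler_pXn2r (n := 2))// ?nnegrE ?enorm_ge0// enorm_sqr.
Qed.

Lemma enorm_coord {R : realType} {k : nat} (u : 'cV[R]_k) i :
  `|u i 0| <= enorm u.
Proof.
rewrite -(ler_pXn2r (n := 2))// ?nnegrE ?enorm_ge0// enorm_sqr dotE.
rewrite (bigD1 i)//= -expr2 real_normK ?num_real// lerDl sumr_ge0// => j _.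
by rewrite -expr2 sqr_ge0.
Qed.

Lemma enorm_le_coord {R : realType} {k : nat} (u : 'cV[R]_k) (c : R) :
  0 <= c -> (forall i, `|u i 0| <= c) -> enorm u <= Num.sqrt k%:R * c.
Proof.
move=> c0 uc; apply: enorm_le_sqr; first by rewrite mulr_ge0 ?sqrtr_ge0.
rewrite exprMn sqr_sqrtr ?ler0n// dotE mulr_natl.
have -> : c ^+ 2 *+ k = \sum_(i < k) c ^+ 2 by rewrite sumr_const card_ord.
apply: ler_sum => i _; rewrite -expr2 -(real_normK (num_real (u i 0))).
by rewrite ler_pXn2r ?nnegrE.
Qed.

Lemma enorm_mulmx {R : realType} {k l : nat} (M : 'M[R]_(k, l)) :
  exists2 L : R, 0 < L & forall u, enorm (M *m u) <= L * enorm u.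
Proof.
pose S := \sum_i enorm (row i M)^T.
have S0 : 0 <= S by apply: sumr_ge0 => i _; exact: enorm_ge0.
have L0 : 0 <= Num.sqrt k%:R * S by rewrite mulr_ge0 ?sqrtr_ge0.
exists (Num.sqrt k%:R * S + 1) => [|u]; first by rewrite ltr_wpDl.
rewrite mulrDl mul1r -mulrA ler_wpDr ?enorm_ge0//.
apply: enorm_le_coord => [|i]; first by rewrite mulr_ge0 ?enorm_ge0.
have -> : (M *m u) i 0 = dot (row i M)^T u.
  by rewrite /dot trmxK -row_mul [RHS]mxE.
apply: le_trans (normr_dot_le _ _) _; apply: ler_wpM2r; first exact: enorm_ge0.
rewrite /S (bigD1 i)//= lerDl sumr_ge0// => j _; exact: enorm_ge0.
Qed.

Lemma normr_le_enorm {R : realType} {k : nat} (u : 'cV[R]_k) : `|u| <= enorm u.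
Proof.
rewrite [leLHS]/Num.norm /= mx_normrE; apply: bigmax_le => [|[i j] _]; first exact: enorm_ge0.
by rewrite /= ord1 enorm_coord.
Qed.

Lemma enorm_le_normr {R : realType} {k : nat} (u : 'cV[R]_k) :
  enorm u <= Num.sqrt k%:R * `|u|.
Proof.
apply: enorm_le_coord => // i.
rewrite [leRHS]/Num.norm /= mx_normrE; apply/bigmax_geP; right => /=.
by exists (i, 0).
Qed.

(** Convergence of columns refers to the sup norm; it is equivalent to the Euclidean norm, with
    constants 1 and [Num.sqrt k%:R]. *)
Lemma cvg_enormP {R : realType} {k : nat} (u : nat -> 'cV[R]_k) (l : 'cV[R]_k) :
  u j @[j --> \oo] --> l <-> enorm (u j - l) @[j --> \oo] --> 0.
Proof.
split=> ul.
  apply: (@squeeze_cvgr _ _ _ _ (cst 0)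
    (fun j => Num.sqrt k%:R * `|u j - l|)) => //.
  - by apply: nearW => j; rewrite enorm_ge0 enorm_le_normr.
  - exact: cvg_cst.
  - rewrite -(mulr0 (Num.sqrt k%:R)); apply: cvgM; first exact: cvg_cst.
    rewrite -(@normr0 R 'cV[R]_k) -(subrr l).
    by apply: cvg_norm; apply: cvgB => //; exact: cvg_cst.
apply/cvgrPdistC_le => e e0; move/cvgr0Pnorm_le: ul => /(_ e e0).
apply: filterS => j; rewrite ger0_norm ?enorm_ge0//.
by apply: le_trans; exact: normr_le_enorm.
Qed.

Lemma cauchy_enorm_cvg {R : realType} {k : nat} (u : nat -> 'cV[R]_k) :
  (forall e : R, 0 < e -> exists N, forall i j, (N <= i)%N -> (N <= j)%N ->
     enorm (u i - u j) <= e) ->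
  exists l : 'cV[R]_k, u j @[j --> \oo] --> l.
Proof.
move=> uc; suff /cvg_ex : cvg (u @ \oo) by [].
apply/cauchy_cvgP; apply: cauchy_exP => e e0.
have [N uN] := uc (e / 2) (divr_gt0 e0 (ltr0Sn R 1)).
exists (u N); exists N => // j /= Nj.
rewrite -ball_normE /= (le_lt_trans (normr_le_enorm _))//.
by rewrite (le_lt_trans (uN _ _ (leqnn N) Nj))//; lra.
Qed.

(** * Monotone operators and the proximal point iteration *)

Lemma cvg_dot {R : realType} {k : nat} (u v : nat -> 'cV[R]_k) (a b : 'cV[R]_k) :
  u j @[j --> \oo] --> a -> v j @[j --> \oo] --> b ->
  dot (u j) (v j) @[j --> \oo] --> dot a b.
Proof.
move=> /cvg_enormP ua /cvg_enormP vb.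
apply/subr_cvg0; apply/norm_cvg0P.
apply: (@squeeze_cvgr _ _ _ _ (cst 0) (fun j => enorm (u j - a) * enorm (v j - b)
  + (enorm (u j - a) * enorm b + enorm a * enorm (v j - b)))).
- apply: nearW => j; rewrite normr_ge0 /=.
  have -> : dot (u j) (v j) - dot a b = dot (u j - a) (v j - b)
      + (dot (u j - a) b + dot a (v j - b)) by rewrite !dot_linE; ring.
  apply: le_trans (ler_normD _ _) (lerD (normr_dot_le _ _) _).
  exact: le_trans (ler_normD _ _) (lerD (normr_dot_le _ _) (normr_dot_le _ _)).
- exact: cvg_cst.
- rewrite -[X in _ --> X]addr0 -[X in _ --> X + _](mulr0 0).
  apply: cvgD; first exact: cvgM.
  rewrite -[X in _ --> X]addr0 -[X in _ --> X + _](mul0r (enorm b)).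
  rewrite -[X in _ --> _ + X](mulr0 (enorm a)).
  by apply: cvgD; apply: cvgM => //; exact: cvg_cst.
Qed.

Definition monotone_op {R : realType} {k : nat} (T : 'cV[R]_k -> set 'cV[R]_k) :=
  forall x u p r, T x p -> T u r -> 0 <= dot (x - u) (p - r).

(** Maximality in Minty's form: [0] lies in [T x + s (x - c)], so [x] is a resolvent of [T] at
    [c]. *)
Definition total_resolvent {R : realType} {k : nat}
    (T : 'cV[R]_k -> set 'cV[R]_k) :=
  forall (s : R) (c : 'cV[R]_k), 0 < s -> exists x, T x (s *: (c - x)).

(* Tikhonov regularisation: the solutions [x j] of [0 \in T x + x / (j + 1)]
   have [- x j / (j + 1)] converging to the least-norm point [d] of the closure
   of the range of [T]. *)
Lemma least_norm_range {R : realType} {k : nat} (T : 'cV[R]_k -> set 'cV[R]_k) :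
  monotone_op T -> total_resolvent T ->
  exists d : 'cV[R]_k,
    (forall x p, T x p -> dot d d <= dot d p) /\
    exists x p : nat -> 'cV[R]_k,
      (forall j, T (x j) (p j)) /\ p j @[j --> \oo] --> d.
Proof.
move=> mT rT.
have /choice[x xT] : forall j : nat, exists y, T y (j.+1%:R^-1 *: (0 - y)).
  by move=> j; apply: rT; rewrite invr_gt0.
have [p xp] : exists p : nat -> 'cV[R]_k, forall j, x j = - (j.+1%:R *: p j).
  exists (fun j => j.+1%:R^-1 *: (0 - x j)) => j.
  by rewrite scalerA divff ?pnatr_eq0// scale1r sub0r opprK.
have {}xT j : T (x j) (p j).
  have := xT j; rewrite sub0r {2}xp opprK scalerA mulVf ?pnatr_eq0//.
  by rewrite scale1r.
pose A j := dot (p j) (p j).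
(* With [s = i + 1], [t = j + 1], monotonicity between [x i] and [x j], added to
   [s |p i - p j|^2 >= 0], gives [(t - s) (<p i, p j> - |p j|^2) >= 0]. Hence
   [<p i, p j> >= |p j|^2], and expanding the square gives the bound. It makes [A] nonincreasing and
   [p] Cauchy. *)
have pA i j : (i <= j)%N -> dot (p i - p j) (p i - p j) <= A i - A j.
  rewrite leq_eqVlt => /predU1P[->|ij]; first by rewrite !subrr dot0r.
  have := mT _ _ _ _ (xT j) (xT i); rewrite !xp !dot_linE (dotC (p j) (p i)).
  have := dot_ge0 (p i - p j); rewrite !dot_linE (dotC (p j) (p i)) /A.
  have : (i.+1%:R : R) < j.+1%:R by rewrite ltr_nat.
  have : (0 : R) < i.+1%:R by [].
  move: (dot (p i) (p i)) (dot (p j) (p j)) (dot (p i) (p j)) => a b c.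
  move: (i.+1%:R : R) (j.+1%:R : R) => s t s0 st h1 h2.
  have {}h2 : 0 <= (t - s) * (c - b).
    have : 0 <= s * (a - c - c + b) by rewrite mulr_ge0//; lra.
    by lra.
  have : 0 <= c - b by rewrite -(@pmulr_rge0 _ (t - s))// subr_gt0.
  by lra.
have Anoninc : nonincreasing_seq A.
  move=> i j ij; have := pA _ _ ij; have := dot_ge0 (p i - p j); lra.
have /cvg_ex[l Al] : cvgn A.
  apply: nonincreasing_is_cvgn => //; exists 0 => _ [j _ <-]; exact: dot_ge0.
have [|d pd] := @cauchy_enorm_cvg _ _ p.
  move=> e e0; have e20 : 0 < e ^+ 2 / 2 by rewrite divr_gt0 ?exprn_gt0.
  have [N _ AN] := (cvgrPdist_le _ _).1 Al _ e20.
  exists N => i j Ni Nj; apply: enorm_le_sqr; first exact: ltW.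
  have := AN _ Ni; have := AN _ Nj; rewrite !ler_norml /=.
  move=> /andP[h1 h2] /andP[h3 h4].
  have [/pA|/ltnW/pA] := leqP i j; first by lra.
  by rewrite -opprB dotNl dotNr opprK; lra.
exists d; split; last by exists x, p.
move=> y r yr; rewrite -subr_le0 -dotNr -dotDr.
(* Monotonicity between [x j] and [y], divided by [j + 1], reads [<p j, p j - r> <= b j]; since [b]
   tends to 0, the limit is [<d, d - r> <= 0]. *)
pose b j := - (harmonic j * dot y (p j - r)).
have pr : p j - r @[j --> \oo] --> d - r by apply: cvgB => //; exact: cvg_cst.
apply: (@ler_cvg_to _ \oo _ _ (fun j => dot (p j) (p j - r)) b).
- exact: cvg_dot.
- rewrite -oppr0; apply: cvgN; rewrite -(mul0r (dot y (d - r))); apply: cvgM.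
    exact: cvg_harmonic.
  by apply: cvg_dot => //; exact: cvg_cst.
- apply: nearW => j; have := mT _ _ _ _ (xT j) yr.
  rewrite xp dotDl !dotNl dotZl /b /harmonic /=.
  set P := dot (p j) _; set Y := dot y _; set n := (j.+1%:R : R) => h.
  have n0 : 0 < n by [].
  by rewrite -mulrN ler_pdivlMl//; lra.
Qed.

(** Monotonicity says that the output difference [u = a - b] and the input difference [v = c - g]
    satisfy [<u, v - u> >= 0]; expand [|v|^2] around [u]. *)
Lemma resolvent_firmly_nonexpansive {R : realType} {k : nat}
    (T : 'cV[R]_k -> set 'cV[R]_k) (s : R) (a b c g : 'cV[R]_k) :
  monotone_op T -> 0 < s -> T a (s *: (c - a)) -> T b (s *: (g - b)) ->
  dot (a - b) (a - b) + dot ((c - g) - (a - b)) ((c - g) - (a - b))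
    <= dot (c - g) (c - g).
Proof.
move=> mT s0 Ta Tb; have := mT _ _ _ _ Ta Tb.
have -> : s *: (c - a) - s *: (g - b) = s *: ((c - g) - (a - b)).
  by apply/colP => i; rewrite !mxE; ring.
rewrite dotZr pmulr_rge0//; move: (a - b) (c - g) => u v.
by rewrite !dot_linE (dotC v u); lra.
Qed.

(** Adding to [A k] the tail [K kappa^k / (1 - kappa)] of the geometric series of errors gives a
    nonincreasing potential. *)
Lemma quasi_fejer_bounded {R : realType} (kappa K : R) (A : nat -> R) :
  0 < kappa < 1 -> 0 <= K -> (forall k, A k.+1 <= A k + K * kappa ^+ k) ->
  forall k, A k <= A 0%N + K / (1 - kappa).
Proof.
move=> /andP[k0 k1] K0 hA k; have k1' : 0 < 1 - kappa by rewrite subr_gt0.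
suff : A k + K * kappa ^+ k / (1 - kappa) <= A 0%N + K / (1 - kappa).
  by apply: le_trans; rewrite lerDl divr_ge0 ?mulr_ge0 ?exprn_ge0// ltW.
elim: k => [|k IH]; first by rewrite expr0 mulr1.
apply: le_trans IH; apply: le_trans (lerD (hA k) (lexx _)) _.
rewrite -addrA lerD2l exprS le_eqVlt; apply/orP; left; apply/eqP; field.
exact: lt0r_neq0.
Qed.

(** The same potential converges, and each of its decrements dominates [Q k]. *)
Lemma quasi_fejer_cvg0 {R : realType} (kappa K : R) (A Q : nat -> R) :
  0 < kappa < 1 -> 0 <= K -> (forall k, 0 <= A k) -> (forall k, 0 <= Q k) ->
  (forall k, A k.+1 + Q k <= A k + K * kappa ^+ k) ->
  Q k @[k --> \oo] --> 0.
Proof.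
move=> /andP[k0 k1] K0 A0 Q0 hA; have k1' : 0 < 1 - kappa by rewrite subr_gt0.
pose E k := A k + K * kappa ^+ k / (1 - kappa).
have EQ k : Q k <= E k - E k.+1.
  have -> : E k - E k.+1 = A k + K * kappa ^+ k - A k.+1.
    by rewrite /E exprS; field; exact: lt0r_neq0.
  by have := hA k; lra.
have E0 k : 0 <= E k.
  by rewrite addr_ge0// divr_ge0 ?mulr_ge0 ?exprn_ge0// ltW.
have /cvg_ex[l El] : cvgn E.
  apply: nonincreasing_is_cvgn; last by exists 0 => _ [j _ <-].
  by apply/nonincreasing_seqP => j; have := EQ j; have := Q0 j; lra.
apply: (@squeeze_cvgr _ _ _ _ (cst 0) (fun k => E k - E k.+1)).
- by apply: nearW => j; rewrite Q0 EQ.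
- exact: cvg_cst.
- rewrite -(subrr l); apply: cvgB => //.
  by rewrite -(cvg_shiftS E) in El.
Qed.

(** [D] and [D'] are the input and output differences of the resolvent along the inexact and the
    exact trajectory. Firm nonexpansiveness makes [|x j - u j|] and then its square quasi-Fejer,
    which forces [D - D'] to 0; the difference of the two increments is [D - D'] up to geometric
    errors. *)
Lemma resolvent_trajectories_asymptotic {R : realType} {k : nat}
    (T : 'cV[R]_k -> set 'cV[R]_k) (s kappa C : R) (x x' e u : nat -> 'cV[R]_k) :
  monotone_op T -> 0 < s -> 0 < kappa < 1 ->
  (forall j, T (x' j) (s *: (x j + e j - x' j))) ->
  (forall j, enorm (e j) <= C * kappa ^+ j) ->
  (forall j, enorm (x' j - x j.+1) <= C * kappa ^+ j) ->
  (forall j, T (u j.+1) (s *: (u j - u j.+1))) ->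
  enorm ((x j - x j.+1) - (u j - u j.+1)) @[j --> \oo] --> 0.
Proof.
move=> mT s0 k01 xT he hx uT; have /andP[k0 k1] := k01.
pose D j := x j + e j - u j; pose D' j := x' j - u j.+1.
have fne j : dot (D' j) (D' j) + dot (D j - D' j) (D j - D' j)
    <= dot (D j) (D j).
  exact: resolvent_firmly_nonexpansive mT s0 (xT j) (uT j).
have C0 : 0 <= C by have := he 0%N; rewrite expr0 mulr1; apply: le_trans; exact: enorm_ge0.
have kj j : 0 <= kappa ^+ j <= 1 by rewrite exprn_ge0 ?exprn_ile1 ?ltW.
pose A j := enorm (x j - u j).
have DA j : enorm (D j) <= A j + C * kappa ^+ j.
  have -> : D j = (x j - u j) + e j by rewrite /D addrAC.
  by apply: le_trans (enormD _ _) _; rewrite lerD2l.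
have D'D j : enorm (D' j) <= enorm (D j).
  apply: enorm_le_sqr; first exact: enorm_ge0.
  by rewrite enorm_sqr; have := fne j; have := dot_ge0 (D j - D' j); lra.
have AD' j : A j.+1 <= enorm (D' j) + C * kappa ^+ j.
  have -> : A j.+1 = enorm (D' j - (x' j - x j.+1)).
    by congr enorm; apply/colP => i; rewrite !mxE; ring.
  by apply: le_trans (enormD _ _) _; rewrite lerD2l enormN.
have A0 j : 0 <= A j by exact: enorm_ge0.
have CC0 : 0 <= 2 * C by rewrite mulr_ge0.
pose M := A 0%N + 2 * C / (1 - kappa).
have AM j : A j <= M.
  apply: quasi_fejer_bounded => // i.
  by have := DA i; have := D'D i; have := AD' i; lra.
have M0 : 0 <= M by exact: le_trans (A0 0%N) (AM _).
have Q0 : dot (D j - D' j) (D j - D' j) @[j --> \oo] --> 0.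
  (* With [t = C kappa^j], squaring [A j.+1 <= |D'| + t] and [|D| <= A j + t] leaves the excess
     [2 |D'| t + 2 A j t + 2 t^2], which is at most [4 (M + C) t] because [|D'| <= M + C],
     [A j <= M] and [t <= C]. *)
  apply: (@quasi_fejer_cvg0 _ kappa (4 * C * (M + C)) (fun j => A j ^+ 2)) => //.
  - by rewrite !mulr_ge0// addr_ge0.
  - by move=> j; rewrite sqr_ge0.
  - by move=> j; exact: dot_ge0.
  move=> j; have := fne j; rewrite -!(enorm_sqr (D' j)) -!(enorm_sqr (D j)).
  have /andP[kj0 kj1] := kj j.
  have := DA j; have := D'D j; have := AD' j; have := AM j; have := A0 j.
  have := A0 j.+1; have := enorm_ge0 (D' j); have := enorm_ge0 (D j).
  move: (enorm (D j)) (enorm (D' j)) (A j) (A j.+1) (dot _ _) => d d' a a1 Q.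
  set t := C * kappa ^+ j => d0 d'0 a10 a0 aM a1d' d'd da h.
  have t0 : 0 <= t by rewrite mulr_ge0.
  have tC : t <= C by rewrite ler_piMr.
  have -> : 4 * C * (M + C) * kappa ^+ j = 4 * (M + C) * t by rewrite /t; ring.
  have h1 : a1 ^+ 2 <= (d' + t) ^+ 2 by rewrite ler_pXn2r ?nnegrE//; lra.
  have h2 : d ^+ 2 <= (a + t) ^+ 2 by rewrite ler_pXn2r ?nnegrE//; lra.
  have h3 : d' * t <= (M + C) * t by rewrite ler_wpM2r//; lra.
  have h4 : a * t <= M * t by rewrite ler_wpM2r//; lra.
  have h5 : t * t <= C * t by rewrite ler_wpM2r//; lra.
  by lra.
apply: (@squeeze_cvgr _ _ _ _ (cst 0)
  (fun j => enorm (D j - D' j) + 2 * C * kappa ^+ j)).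
- apply: nearW => j; rewrite enorm_ge0 /=.
  have -> : x j - x j.+1 - (u j - u j.+1)
      = (D j - D' j) + ((x' j - x j.+1) - e j).
    rewrite /D /D'; apply/colP => i; rewrite !mxE; ring.
  apply: le_trans (enormD _ _) _; rewrite lerD2l.
  apply: le_trans (enormD _ _) _; rewrite enormN.
  by have := he j; have := hx j; lra.
- exact: cvg_cst.
- rewrite -[X in _ --> X]addr0; apply: cvgD.
    have := cvg_comp _ Num.sqrt Q0 (@sqrt_continuous R 0).
    by rewrite sqrtr0.
  rewrite -(mulr0 (2 * C)); apply: cvgM; first exact: cvg_cst.
  by apply: cvg_expr; rewrite ger0_norm ?ltW.
Qed.

(** Monotonicity gives [<c, p - c> >= 0]. Along an exact proximal trajectory the [T]-values
    therefore never grow in norm. *)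
Lemma resolvent_iterates_decrease {R : realType} {k : nat}
    (T : 'cV[R]_k -> set 'cV[R]_k) (s : R) (a b p c : 'cV[R]_k) :
  monotone_op T -> 0 < s -> T a p -> T b c -> c = s *: (a - b) ->
  dot c c <= dot p p.
Proof.
move=> mT s0 Ta Tb cE; have := mT _ _ _ _ Ta Tb.
have -> : a - b = s^-1 *: c by rewrite cE scalerA mulVf ?scale1r// gt_eqF.
rewrite dotZl pmulr_rge0 ?invr_gt0// dotDr dotNr subr_ge0 => h.
by have := dot_ge0 (p - c); rewrite !dot_linE (dotC p c); lra.
Qed.

Lemma inexact_proximal_point_cvg {R : realType} {k : nat}
    (T : 'cV[R]_k -> set 'cV[R]_k) (s kappa C : R) (x x' e : nat -> 'cV[R]_k) :
  monotone_op T -> total_resolvent T -> 0 < s -> 0 < kappa < 1 ->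
  (forall j, T (x' j) (s *: (x j + e j - x' j))) ->
  (forall j, enorm (e j) <= C * kappa ^+ j) ->
  (forall j, enorm (x' j - x j.+1) <= C * kappa ^+ j) ->
  exists dx : 'cV[R]_k,
    [/\ x j.+1 - x j @[j --> \oo] --> dx,
        forall y p, T y p -> dot dx p <= - s * dot dx dx
      & exists y p : nat -> 'cV[R]_k,
          (forall j, T (y j) (p j)) /\ p j @[j --> \oo] --> - s *: dx].
Proof.
move=> mT rT s0 k01 xT he hx.
have [d [dmin [y [p [yp pd]]]]] := least_norm_range _ mT rT.
have sN0 : s != 0 by rewrite gt_eqF.
pose dx := - s^-1 *: d.
have dE : d = - s *: dx by rewrite /dx scalerA mulrNN divff ?scale1r.
exists dx; split; last by exists y, p; rewrite -dE.
- suff xd : s *: (x j - x j.+1) @[j --> \oo] --> d.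
    have -> : (fun j => x j.+1 - x j) = (fun j => - s^-1 *: (s *: (x j - x j.+1))).
      by apply/funext => j; rewrite scalerA mulNr mulVf// scaleN1r opprB.
    by apply: cvgZ => //; exact: cvg_cst.
  apply/cvg_enormP/cvgr0Pnorm_le => ep ep0.
  have dd : dot (p j) (p j) @[j --> \oo] --> dot d d by exact: cvg_dot.
  have e20 : 0 < (ep / 2) ^+ 2 by rewrite exprn_gt0// divr_gt0.
  have [N _ /(_ _ (leqnn N))] := (cvgrPdistC_le _ _).1 dd _ e20.
  move=> /(le_trans (ler_norm _)) /= pN.
  have /choice[J JT] : forall c, exists z, T z (s *: (c - z)).
    by move=> c; exact: rT.
  (* The comparison trajectory depends on [ep]: it starts at a point with a [T]-value whose squared
     norm exceeds [|d|^2] by at most [(ep / 2)^2]. *)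
  pose u j := iter j J (y N).
  have uT j : T (u j.+1) (s *: (u j - u j.+1)) by exact: JT.
  pose r j := s *: (u j - u j.+1).
  have rp j : dot (r j) (r j) <= dot (p N) (p N).
    elim: j => [|j]; last apply: le_trans.
      exact: resolvent_iterates_decrease mT s0 (yp N) (uT 0%N) erefl.
    exact: resolvent_iterates_decrease mT s0 (uT j) (uT j.+1) erefl.
  (* Minimality of [d] gives [|r j - d|^2 <= |r j|^2 - |d|^2], and [|r j|] stays below its initial
     bound. *)
  have rd j : enorm (r j - d) <= ep / 2.
    apply: enorm_le_sqr; first by rewrite divr_ge0 ?ltW.
    have := rp j; have := dmin _ _ (uT j); rewrite -/(r j) => h1 h2.
    by rewrite dot_sqrB (dotC _ d); lra.
  have e2s : 0 < ep / 2 / s by rewrite !divr_gt0.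
  have := resolvent_trajectories_asymptotic _ _ _ _ _ _ _ _ mT s0 k01 xT he hx uT.
  move/cvgr0Pnorm_le => /(_ _ e2s); apply: filterS => j.
  rewrite !ger0_norm ?enorm_ge0// => h.
  have -> : s *: (x j - x j.+1) - d
      = s *: (x j - x j.+1 - (u j - u j.+1)) + (r j - d).
    by apply/colP => i; rewrite !mxE; ring.
  apply: le_trans (enormD _ _) _; rewrite enormZ gtr0_norm//.
  by have := rd j; move: h; rewrite ler_pdivlMr//; lra.
- move=> z q /dmin; rewrite dE !dot_linE => h.
  by rewrite -(@ler_nM2l _ (- s)) ?oppr_lt0//; lra.
Qed.

(** * Projection onto the nonnegative orthant and fixed points of contractions *)

Definition vpos {R : realType} {k : nat} (u : 'cV[R]_k) : 'cV[R]_k :=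
  \col_i Num.max (u i 0) 0.

Lemma normr_max0_sub {R : realType} (a b : R) :
  (Num.max a 0 - Num.max b 0) ^+ 2 <= (a - b) ^+ 2.
Proof.
rewrite /Num.max; case: ifP => a0; case: ifP => b0 //.
- by rewrite subrr expr0n sqr_ge0.
- by move/negbT: b0; rewrite -leNgt => b0; nra.
- by move/negbT: a0; rewrite -leNgt => a0; nra.
Qed.

Lemma dot_vpos_sub {R : realType} {k : nat} (u v : 'cV[R]_k) :
  dot (vpos u - vpos v) (vpos u - vpos v) <= dot (u - v) (u - v).
Proof.
rewrite !dotE; apply: ler_sum => i _; rewrite !mxE -!expr2.
exact: normr_max0_sub.
Qed.

(** Banach's fixed-point theorem in the Euclidean norm: the iterates from 0 are Cauchy, and their
    limit [l] satisfies [|phi l - l| <= c |u j - l| + |u j.+1 - l|]. *)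
Lemma enorm_contraction_fixpoint {R : realType} {k : nat}
    (phi : 'cV[R]_k -> 'cV[R]_k) (c : R) :
  0 < c < 1 -> (forall u v, enorm (phi u - phi v) <= c * enorm (u - v)) ->
  exists x, phi x = x.
Proof.
move=> /andP[c0 c1] hc; pose u j := iter j phi 0.
have c1' : 0 < 1 - c by rewrite subr_gt0.
pose D := enorm (u 1%N - u 0%N).
have D0 : 0 <= D by exact: enorm_ge0.
have uS j : enorm (u j.+1 - u j) <= D * c ^+ j.
  elim: j => [|j IH]; first by rewrite expr0 mulr1.
  apply: le_trans (hc _ _) _; rewrite exprS mulrCA ler_wpM2l//; exact: ltW.
have uD i j : enorm (u (i + j)%N - u i) <= D / (1 - c) * c ^+ i.
  (* Keeping the subtracted term [c ^+ (i + j)] of the partial geometric sum makes the induction on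
     [j] close. *)
  suff : enorm (u (i + j)%N - u i) <= D / (1 - c) * (c ^+ i - c ^+ (i + j)).
    move=> /le_trans; apply; rewrite ler_wpM2l//; first by rewrite divr_ge0// ltW.
    by rewrite gerBl exprn_ge0 ?ltW.
  elim: j => [|j IH]; first by rewrite addn0 !subrr enorm0 mulr0.
  rewrite addnS.
  have -> : u (i + j).+1 - u i = (u (i + j).+1 - u (i + j)%N) + (u (i + j)%N - u i).
    by rewrite addrA subrK.
  apply: le_trans (enormD _ _) _; apply: le_trans (lerD (uS _) IH) _.
  rewrite exprS le_eqVlt; apply/orP; left; apply/eqP; field.
  exact: lt0r_neq0.
have [|l ul] := @cauchy_enorm_cvg _ _ u.
  move=> ep ep0; set K := D / (1 - c) in uD.
  have K0 : 0 <= K by rewrite divr_ge0// ltW.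
  have : K * c ^+ j @[j --> \oo] --> 0.
    rewrite -(mulr0 K); apply: cvgM; first exact: cvg_cst.
    by apply: cvg_expr; rewrite ger0_norm ?ltW.
  move/cvgr0Pnorm_le => /(_ _ ep0) [N _ hN]; exists N.
  have {}uD i j : (N <= i)%N -> (i <= j)%N -> enorm (u j - u i) <= ep.
    move=> Ni ij; rewrite -(subnKC ij); apply: le_trans (uD _ _) _.
    by have := hN i Ni; apply: le_trans; exact: ler_norm.
  move=> i j Ni Nj; have [ij|/ltnW ji] := leqP i j; last exact: uD.
  by rewrite enormBC; exact: uD.
exists l; apply/eqP; rewrite -subr_eq0; apply/eqP/enorm_eq0.
move/cvg_enormP in ul.
apply: (@ler_cvg_to _ \oo _ _ (cst (enorm (phi l - l)))
   (fun j => c * enorm (u j - l) + enorm (u j.+1 - l))).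
- exact: cvg_cst.
- rewrite -[X in _ --> X]addr0; apply: cvgD.
    by rewrite -(mulr0 c); apply: cvgM => //; exact: cvg_cst.
  by rewrite -(cvg_shiftS (fun j => enorm (u j - l))) in ul.
- apply: nearW => j /=.
  have -> : phi l - l = (phi l - u j.+1) + (u j.+1 - l) by rewrite addrA subrK.
  apply: le_trans (enormD _ _) _; rewrite lerD2r (enormBC (u j)).
  exact: hc.
Qed.

(** * The KKT operator *)

Lemma vec3K {R : realType} {n m q : nat} (x : 'cV[R]_(n + (m + q))) :
  col_mx (zpart x) (col_mx (lpart x) (vpart x)) = x.
Proof. by rewrite /zpart /lpart /vpart !vsubmxK. Qed.

Lemma zpartE {R : realType} {n m q : nat} (z : 'cV[R]_n) (l : 'cV[R]_m)
  (v : 'cV[R]_q) : zpart (col_mx z (col_mx l v)) = z.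
Proof. exact: col_mxKu. Qed.

Lemma lpartE {R : realType} {n m q : nat} (z : 'cV[R]_n) (l : 'cV[R]_m)
  (v : 'cV[R]_q) : lpart (col_mx z (col_mx l v)) = l.
Proof. by rewrite /lpart col_mxKd col_mxKu. Qed.

Lemma vpartE {R : realType} {n m q : nat} (z : 'cV[R]_n) (l : 'cV[R]_m)
  (v : 'cV[R]_q) : vpart (col_mx z (col_mx l v)) = v.
Proof. by rewrite /vpart !col_mxKd. Qed.

Definition partE {R : realType} {n m q : nat} :=
  (@zpartE R n m q, @lpartE R n m q, @vpartE R n m q).

Lemma dot_vec3 {R : realType} {n m q : nat} (x y : 'cV[R]_(n + (m + q))) :
  dot x y = dot (zpart x) (zpart y)
            + (dot (lpart x) (lpart y) + dot (vpart x) (vpart y)).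
Proof. by rewrite -{1}(vec3K x) -{1}(vec3K y) !dot_col_mx. Qed.

Lemma vec3B {R : realType} {n m q : nat} (x y : 'cV[R]_(n + (m + q))) :
  x - y = col_mx (zpart x - zpart y)
            (col_mx (lpart x - lpart y) (vpart x - vpart y)).
Proof. by rewrite -{1}(vec3K x) -{1}(vec3K y) !opp_col_mx !add_col_mx. Qed.

Lemma KKT_mulE {R : realType} {n m q : nat} (P : qp_data R n m q)
    (z : 'cV[R]_n) (l : 'cV[R]_m) (v : 'cV[R]_q) :
  KKT_mx P *m col_mx z (col_mx l v) =
  col_mx (qpH P *m z + (qpG P)^T *m l + (qpA P)^T *m v)
    (col_mx (- (qpG P *m z)) (- (qpA P *m z))).
Proof.
by rewrite /KKT_mx mul_block_col mul_row_col mul_col_mx !mulNmx mul0mx addr0 addrA.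
Qed.

Lemma FmapE {R : realType} {n m q : nat} (P : qp_data R n m q)
    (z : 'cV[R]_n) (l : 'cV[R]_m) (v : 'cV[R]_q) :
  Fmap P (col_mx z (col_mx l v)) =
  col_mx (qpH P *m z + qpf P + (qpG P)^T *m l + (qpA P)^T *m v)
    (col_mx (qph P - qpG P *m z) (qpb P - qpA P *m z)).
Proof.
rewrite /Fmap KKT_mulE /KKT_vec !add_col_mx.
congr col_mx; last by congr col_mx; rewrite addrC.
by rewrite addrAC [X in X + _]addrAC.
Qed.

Lemma FmapB {R : realType} {n m q : nat} (P : qp_data R n m q) x y :
  Fmap P x - Fmap P y = KKT_mx P *m (x - y).
Proof. by rewrite /Fmap opprD addrACA subrr addr0 mulmxBr. Qed.

(** The off-diagonal blocks are skew and cancel, leaving [z^T H z]. *)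
Lemma KKT_mx_monotone {R : realType} {n m q : nat} (P : qp_data R n m q) x :
  symmetric_psd (qpH P) -> 0 <= dot x (KKT_mx P *m x).
Proof.
move=> [_ Hpsd]; rewrite -(vec3K x) KKT_mulE !dot_col_mx !dot_linE.
rewrite !(dot_mulmx _ _^T) !trmxK (dotC (lpart x)) (dotC (vpart x)).
by have := Hpsd (zpart x); lra.
Qed.

Lemma Tmap_monotone {R : realType} {n m q : nat} (P : qp_data R n m q) :
  symmetric_psd (qpH P) -> monotone_op (Tmap P).
Proof.
move=> Hpsd x u _ _ [p [Cx px] <-] [r [Cu ru] <-].
have -> : Fmap P x + p - (Fmap P u + r) = KKT_mx P *m (x - u) + (p - r).
  by rewrite -FmapB opprD addrACA.
have := KKT_mx_monotone P (x - u) Hpsd; have := px _ Cu; have := ru _ Cx.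
by rewrite -(opprB x u) !(dotNl, dotDr (x - u)) dotNr; lra.
Qed.

(** By complementarity [- (0, 0, y)] is normal to the cone at [x]: its product with [x - u] is
    [<vpart u, y> >= 0]. *)
Lemma Tmap_intro {R : realType} {n m q : nat} (P : qp_data R n m q)
    (x : 'cV[R]_(n + (m + q))) (y : 'cV[R]_q) :
  vle 0 (vpart x) -> vle 0 y -> dot (vpart x) y = 0 ->
  Tmap P x (Fmap P x - col_mx 0 (col_mx 0 y)).
Proof.
move=> x0 y0 xy; exists (- col_mx 0 (col_mx 0 y)) => //; split=> // u Cu.
rewrite vec3B dotNr !dot_col_mx !dot0r !add0r dotDl dotNl xy sub0r opprK.
exact: dot_ge0_vle.
Qed.

Lemma max_fixpoint_complementary {R : realType} (t v g : R) :
  0 < t -> Num.max (v - t * g) 0 = v -> [/\ 0 <= v, 0 <= g & v * g = 0].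
Proof.
move=> t0; case: (ltP (v - t * g) 0) => [h v0|h /eqP].
  rewrite -v0 mul0r; split=> //; move: h; rewrite -v0 sub0r oppr_lt0.
  by rewrite pmulr_rgt0// => /ltW.
rewrite -subr_eq0 addrAC subrr sub0r oppr_eq0 mulf_eq0 gt_eqF//= => /eqP g0.
by move: h; rewrite g0 !mulr0 subr0.
Qed.

(** The inclusion is a strongly monotone affine variational inequality with map [g]. The projected
    step [phi] with step length [t] is a contraction, and its fixed point satisfies the
    complementarity conditions. *)
Lemma Tmap_resolvent {R : realType} {n m q : nat} (P : qp_data R n m q) :
  symmetric_psd (qpH P) -> total_resolvent (Tmap P).
Proof.
move=> Hpsd s c s0; pose M := KKT_mx P + s%:M.
(* Adding [s] to the bound [L0] ensures [s / L < 1], so the contraction factor is positive. *)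
have [L0 L00 ML0] := enorm_mulmx M; pose L := L0 + s.
have L_gt0 : 0 < L by exact: addr_gt0.
have ML u : dot (M *m u) (M *m u) <= L ^+ 2 * dot u u.
  rewrite -!enorm_sqr -exprMn; apply: lerXn2r; rewrite ?nnegrE ?enorm_ge0//.
    by rewrite mulr_ge0 ?enorm_ge0// ltW.
  apply: le_trans (ML0 u) _; rewrite ler_wpM2r ?enorm_ge0// lerDl; exact: ltW.
have Ms u : s * dot u u <= dot u (M *m u).
  rewrite mulmxDl mul_scalar_mx !dot_linE lerDr; exact: KKT_mx_monotone.
(* This [t] minimises the squared contraction factor [1 - 2 t s + t^2 L^2], with minimum
   [1 - (s / L)^2]. *)
pose t := s / L ^+ 2; have t0 : 0 < t by rewrite divr_gt0 ?exprn_gt0.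
pose g x := Fmap P x + s *: (x - c).
have gB x y : g x - g y = M *m (x - y).
  rewrite mulmxDl -FmapB mul_scalar_mx /g.
  by apply/colP => i; rewrite !mxE; ring.
pose phi x := let a := x - t *: g x in
  col_mx (zpart a) (col_mx (lpart a) (vpos (vpart a))).
have k0 : 0 < 1 - (s / L) ^+ 2.
  rewrite subr_gt0 expr_lt1 ?divr_ge0 ?ltW// ltr_pdivrMr// mul1r.
  by rewrite /L ltrDr.
have phiB u v : dot (phi u - phi v) (phi u - phi v)
    <= (1 - (s / L) ^+ 2) * dot (u - v) (u - v).
  pose a := u - t *: g u; pose b := v - t *: g v.
  have ab : a - b = (u - v) - t *: (M *m (u - v)).
    rewrite -gB /a /b; apply/colP => i; rewrite !mxE; ring.
  apply: (@le_trans _ _ (dot (a - b) (a - b))).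
    rewrite /phi -/a -/b (vec3B a b) opp_col_mx add_col_mx opp_col_mx add_col_mx.
    by rewrite !dot_col_mx !lerD2l dot_vpos_sub.
  rewrite ab; have := Ms (u - v); have := ML (u - v); move: (u - v) => w.
  rewrite dot_sqrB !dot_linE.
  move: (dot _ _) (dot _ _) (dot _ _) => X Y Z.
  have -> : (s / L) ^+ 2 = s * t by rewrite /t; field; rewrite gt_eqF.
  rewrite -(ler_pM2l (x := t ^+ 2)) ?exprn_gt0// => h1.
  rewrite -(ler_pM2l t0) => h2.
  have e : t ^+ 2 * (L ^+ 2 * Y) = s * t * Y by rewrite /t; field; rewrite gt_eqF.
  by lra.
pose k := Num.sqrt (1 - (s / L) ^+ 2).
have [||x xphi] := @enorm_contraction_fixpoint _ _ phi k.
- rewrite /k sqrtr_gt0 k0 /= -{2}sqrtr1 ltr_sqrt// gtrBl exprn_gt0//.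
  by rewrite divr_gt0.
- move=> u v; have k1 := ltW k0; rewrite /k /enorm -sqrtrM// ler_sqrt ?phiB//.
  by rewrite mulr_ge0 ?dot_ge0.
have := xphi; rewrite /phi -[X in _ = X]vec3K => /eq_col_mx[xz /eq_col_mx[xl xv]].
have gz : zpart (g x) = 0.
  move: xz; rewrite vec3B zpartE => /eqP; rewrite -subr_eq0 addrAC subrr sub0r.
  rewrite oppr_eq0 /zpart linearZ /= scaler_eq0 gt_eqF//= => /eqP; exact.
have gl : lpart (g x) = 0.
  move: xl; rewrite vec3B lpartE => /eqP; rewrite -subr_eq0 addrAC subrr sub0r.
  rewrite oppr_eq0 /lpart !linearZ /= scaler_eq0 gt_eqF//= => /eqP; exact.
have xg i : [/\ 0 <= vpart x i 0, 0 <= vpart (g x) i 0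
              & vpart x i 0 * vpart (g x) i 0 = 0].
  apply: max_fixpoint_complementary t0 _.
  have := congr1 (fun w : 'cV_q => w i 0) xv.
  have -> : vpart (x - t *: g x) = vpart x - t *: vpart (g x).
    by rewrite /vpart !linearB !linearZ.
  by rewrite !mxE.
exists x.
(* Only the last block of [g x] survives, so [s (c - x) = F x - g x] has the form given by
   [Tmap_intro]. *)
have -> : s *: (c - x) = Fmap P x - col_mx 0 (col_mx 0 (vpart (g x))).
  have -> : col_mx 0 (col_mx 0 (vpart (g x))) = g x.
    by rewrite -[RHS]vec3K gz gl.
  by rewrite /g opprD addrA subrr sub0r -scalerN opprB.
apply: Tmap_intro => [i|i|].
- by rewrite [X in X <= _]mxE; case: (xg i).
- by rewrite [X in X <= _]mxE; case: (xg i).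
- by rewrite dotE big1// => i _; case: (xg i).
Qed.

(** * The residual of the proximal subproblem *)

(** Let [a <= b] and [s = sqrt(a^2 + b^2)]. If [a >= 0], then [s <= a / 2 + b] and the penalty term
    is nonnegative, whence the factor 2. If [a < 0], the penalty vanishes and [b <= s] gives
    [|a| <= s - a - b]. *)
Lemma min_le_pfb {R : realType} (alpha a b : R) : 0 < alpha < 1 ->
  `|Num.min a b| <= 2 / alpha * `|pfb alpha a b|.
Proof.
move=> /andP[al0 al1].
wlog ab : a b / a <= b => [hw|].
  have [/hw//|/hw] := orP (le_total a b).
  rewrite minC; suff -> : pfb alpha b a = pfb alpha a b by [].
  by rewrite /pfb (addrC b a) (addrC (b ^+ 2)) (mulrC (Num.max b 0)).
rewrite (min_idPl ab) mulrAC ler_pdivlMr//.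
have s0 : 0 <= Num.sqrt (a ^+ 2 + b ^+ 2) by rewrite sqrtr_ge0.
have ss : Num.sqrt (a ^+ 2 + b ^+ 2) ^+ 2 = a ^+ 2 + b ^+ 2.
  by rewrite sqr_sqrtr// addr_ge0 ?sqr_ge0.
rewrite /pfb; move: (Num.sqrt _) s0 ss => s s0 ss.
have [a0|a0] := leP 0 a.
  have b0 : 0 <= b by exact: le_trans ab.
  have h : s <= 2^-1 * a + b.
    rewrite -(ler_pXn2r (n := 2))// ?nnegrE//; last by lra.
    by rewrite ss; nra.
  rewrite (max_idPl b0) (ger0_norm a0).
  have p0 : 0 <= (1 - alpha) * (a * b) by rewrite !mulr_ge0//; lra.
  have p1 : 0 <= alpha * (2^-1 * a + b - s) by rewrite mulr_ge0//; lra.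
  apply: (@le_trans _ _ (2 * (alpha * (a + b - s)))); first by nra.
  rewrite ler_pM2l//; apply: le_trans (ler_norm _); lra.
rewrite mul0r mulr0 addr0 normrM (gtr0_norm al0) mulrCA.
rewrite [leLHS]mulrC ler_pM2l//.
have bs : b <= s.
  have [b0|b0] := leP b 0; first exact: le_trans s0.
  by rewrite -(ler_pXn2r (n := 2))// ?nnegrE ?(ltW b0)// ss; nra.
rewrite (ltr0_norm a0) (@le_trans _ _ (2 * - (a + b - s)))//; first lra.
by rewrite ler_pM2l// -normrN ler_norm.
Qed.

(** Subtracting [p = min(y, v)] turns the pair [(v, y)] into the complementary pair [(v - y)_+],
    [(y - v)_+]. The corrected point [x'] is then an exact resolvent at a shifted centre, and
    [min_le_pfb] bounds the correction by the residual. *)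
Lemma Rmap_resolvent {R : realType} {n m q : nat} (P : qp_data R n m q)
    (alpha s : R) : 0 < alpha < 1 -> 0 < s ->
  exists2 C : R, 0 <= C & forall xbar x, exists x' e,
    [/\ Tmap P x' (s *: (xbar + e - x')),
        enorm e <= C * enorm (Rmap P alpha s xbar x)
      & enorm (x' - x) <= C * enorm (Rmap P alpha s xbar x)].
Proof.
move=> al01 s0; have /andP[al0 al1] := al01.
have [L L0 hL] := enorm_mulmx (KKT_mx P).
pose c := Num.sqrt q%:R * (2 / alpha).
have c0 : 0 <= c by rewrite mulr_ge0// divr_ge0// ltW.
pose C := c + s^-1 * (1 + c + L * c).
have C0 : 0 <= s^-1 * (1 + c + L * c).
  rewrite mulr_ge0 ?invr_ge0 ?(ltW s0)// !addr_ge0// mulr_ge0//; exact: ltW.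
exists C; first by rewrite addr_ge0.
move=> xbar x; set r := Rmap P alpha s xbar x.
pose y := qpb P - qpA P *m zpart x + s *: (vpart x - vpart xbar).
pose p : 'cV[R]_q := \col_i Num.min (y i 0) (vpart x i 0).
pose Q : 'cV[R]_(n + (m + q)) := col_mx 0 (col_mx 0 p).
pose x' := x - Q; pose N : 'cV[R]_(n + (m + q)) := col_mx 0 (col_mx 0 (y - p)).
pose r0 : 'cV[R]_(n + (m + q)) := col_mx (zpart r) (col_mx (lpart r) 0).
have FxE : Fmap P x + s *: (x - xbar) = r0 + col_mx 0 (col_mx 0 y).
  rewrite -{1}(vec3K x) FmapE vec3B !scale_col_mx !add_col_mx /r0 /r /Rmap !partE.
  by rewrite !addr0 add0r.
have r0r : enorm r0 <= enorm r.
  apply: enorm_le_sqr; first exact: enorm_ge0.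
  rewrite enorm_sqr (dot_vec3 r) /r0 !dot_col_mx dot0r addr0 addrA lerDl.
  exact: dot_ge0.
have Qr : enorm Q <= c * enorm r.
  have -> : enorm Q = enorm p by rewrite /enorm !dot_col_mx !dot0r !add0r.
  rewrite /c -mulrA; apply: enorm_le_coord => [|i].
    by rewrite mulr_ge0 ?enorm_ge0// divr_ge0// ltW.
  rewrite [p i 0]mxE; apply: le_trans (min_le_pfb _ _ _ al01) _.
  rewrite ler_wpM2l//; first by rewrite divr_ge0// ltW.
  have -> : pfb alpha (y i 0) (vpart x i 0) = vpart r i 0.
    by rewrite /r /Rmap vpartE [RHS]mxE.
  apply: le_trans (enorm_coord (vpart r) i) _.
  apply: enorm_le_sqr; first exact: enorm_ge0.
  by rewrite enorm_sqr (dot_vec3 r) addrA lerDr addr_ge0 ?dot_ge0.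
have r00 := enorm_ge0 r.
(* Solved from [s (xbar + e - x') = F x' - N], the [T]-value available at [x']. *)
pose e := s^-1 *: (Fmap P x' - N) - xbar + x'.
exists x', e; split.
- have -> : s *: (xbar + e - x') = Fmap P x' - N.
    have -> : xbar + e - x' = s^-1 *: (Fmap P x' - N).
      by rewrite /e; apply/colP => i; rewrite !mxE; ring.
    by rewrite scalerA divff ?scale1r ?gt_eqF.
  have -> : x' = col_mx (zpart x) (col_mx (lpart x) (vpart x - p)).
    by rewrite /x' -{1}(vec3K x) !opp_col_mx !add_col_mx !subr0.
  have vp i : (vpart x - p) i 0 = Num.max (vpart x i 0 - y i 0) 0.
    rewrite mxE [in X in _ + X]mxE [p i 0]mxE.
    by case: (leP (y i 0) (vpart x i 0)) => h; case: ltP; lra.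
  have yp i : (y - p) i 0 = Num.max (y i 0 - vpart x i 0) 0.
    rewrite mxE [in X in _ + X]mxE [p i 0]mxE.
    by case: (leP (y i 0) (vpart x i 0)) => h; case: ltP; lra.
  apply: Tmap_intro => [i|i|]; rewrite ?vpartE.
  + by rewrite [X in X <= _]mxE vp le_max lexx orbT.
  + by rewrite [X in X <= _]mxE yp le_max lexx orbT.
  + rewrite dotE big1// => i _; rewrite vp yp.
    case/orP: (le_total (y i 0) (vpart x i 0)) => h.
      by rewrite [X in _ * X](max_idPr _) ?mulr0// subr_le0.
    by rewrite [X in X * _](max_idPr _) ?mul0r// subr_le0.
(* The terms of this formula account for those of [C]: [c] for [Q], then 1 for [r0], [c] for [Q] and
   [L c] for [KKT_mx P *m Q], scaled by [1 / s]. *)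
- have -> : e = - Q + s^-1 *: (r0 + Q - KKT_mx P *m Q).
    have NE : N = col_mx 0 (col_mx 0 y) - Q.
      by rewrite /N /Q !opp_col_mx !add_col_mx !subr0.
    have -> : r0 = Fmap P x + s *: (x - xbar) - col_mx 0 (col_mx 0 y).
      by rewrite FxE addrK.
    have -> : KKT_mx P *m Q = Fmap P x - Fmap P x'.
      by rewrite FmapB /x' opprB addrC subrK.
    rewrite /e NE /x'; apply/colP => i; rewrite !mxE.
    by move: (\sum_(j < _) _) => F; field; rewrite gt_eqF.
  rewrite /C mulrDl; apply: le_trans (enormD _ _) _; rewrite enormN lerD//.
  rewrite enormZ gtr0_norm ?invr_gt0// -mulrA ler_pM2l ?invr_gt0//.
  rewrite !mulrDl mul1r; apply: le_trans (enormD _ _) _; rewrite enormN lerD//.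
    by apply: le_trans (enormD _ _) _; rewrite lerD.
  by apply: le_trans (hL _) _; rewrite -mulrA ler_pM2l.
- rewrite /x' addrAC subrr sub0r enormN; apply: le_trans Qr _.
  by rewrite ler_wpM2r// lerDl.
Qed.

(** The first argument of the minimum contracts by [kappa], from an initial value at most 1. A zero
    [delta] is harmless, since division by it yields 0. *)
Lemma fbstab_delta_bounds {R : realType} {n m q : nat} (P : qp_data R n m q)
    (kappa sigma : R) (x : nat -> 'cV[R]_(n + (m + q))) k :
  0 < kappa < 1 -> 0 < sigma ->
  0 <= fbstab_delta P kappa sigma x k <= kappa ^+ k.
Proof.
move=> /andP[k0 k1] s0; elim: k => [|k /andP[d0 dk]] /=.
  have d0 : 0 <= Num.min (enorm (natural_residual P (x 0%N)) / sigma) 1.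
    by rewrite le_min ler01 divr_ge0 ?enorm_ge0// ltW.
  rewrite le_min mulr_ge0 ?divr_ge0 ?enorm_ge0//=; last exact: ltW.
  rewrite expr0 ge_min; apply/orP; left.
  by rewrite mulr_ile1 ?(ltW k0) ?(ltW k1)// ge_min lexx orbT.
rewrite le_min mulr_ge0 ?divr_ge0 ?enorm_ge0//=; last exact: ltW.
by rewrite ge_min; apply/orP; left; rewrite exprS ler_pM2l.
Qed.

(** Both exits control the residual: it is zero at a root, and the factor [Num.min 1 _] in the
    stopping test is at most 1. *)
Lemma prox_run_residual {R : realType} {n m q : nat} (P : qp_data R n m q)
    (alpha beta eta eps sigma : R) (xbar x r : 'cV[R]_(n + (m + q))) :
  0 <= eps -> prox_run P alpha beta eta eps sigma xbar x r ->
  enorm (Rmap P alpha sigma xbar r) <= eps.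
Proof.
move=> e0; elim=> {x r} [x ->|x x' _ _|//]; first by rewrite enorm0.
by move/le_trans; apply; rewrite ler_piMr// ge_min lexx.
Qed.

Lemma eproj_id {R : realType} {k : nat} (S : set 'cV[R]_k) (x : 'cV[R]_k) :
  S x -> eproj S x = x.
Proof.
move=> Sx; rewrite /eproj; case: xgetP => // p _ [_ /(_ _ Sx)].
by rewrite subrr enorm0 => /enorm_eq0/eqP; rewrite subr_eq0 => /eqP.
Qed.

Lemma le0_of_affine_bound {R : realType} (a b : R) :
  (forall t, 0 <= t -> t * a <= b) -> a <= 0.
Proof.
move=> h; rewrite leNgt; apply/negP => a0.
have b0 : 0 <= b by have := h 0 (lexx _); rewrite mul0r.
have := h ((b + 1) / a); rewrite divr_ge0 ?addr_ge0 ?(ltW a0)// => /(_ isT).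
by rewrite divfK ?gt_eqF//; lra.
Qed.

(** With [w = M z], nonnegativity of the form at [t z - w] gives [2 t |w|^2 <= <w, M w>] for all
    [t >= 0]. *)
Lemma symmetric_psd_eq0 {R : realType} {k : nat} (M : 'M[R]_k) z :
  symmetric_psd M -> dot z (M *m z) <= 0 -> M *m z = 0.
Proof.
move=> [Msym Mpsd] z0; apply: dot_eq0; apply/le_anti; rewrite dot_ge0 andbT.
pose w := M *m z.
have zMw : dot z (M *m w) = dot w w by rewrite dot_mulmx Msym.
suff : 2 * dot w w <= 0 by rewrite -/w; lra.
apply: (@le0_of_affine_bound _ _ (dot w (M *m w))) => t t0.
have [->|t_neq0] := eqVneq t 0; first by rewrite mul0r.
have tp : 0 < t by rewrite lt0r t_neq0.
have := Mpsd (t *: z - w).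
rewrite mulmxBr -scalemxAr -/w.
rewrite dotDl dotNl !dotDr !dotNr !dotZl !dotZr zMw (dotC z w) => h.
have tz : t * (t * dot w z) <= 0.
  by rewrite pmulr_rle0// pmulr_rle0// dotC.
by lra.
Qed.

(** * Infeasibility certificates *)

(* A bound on [<g, .>] over the range of [Tmap P] is tested along rays of the
   cone; with [g = (gz, gl, gv)] the rays through [(gz, 0, 0)] give
   [gz^T H gz <= gl^T G gz + gv^T A gz <= 0]. *)
Lemma least_norm_recession {R : realType} {n m q : nat} (P : qp_data R n m q)
    (c : R) (g : 'cV[R]_(n + (m + q))) :
  symmetric_psd (qpH P) -> (forall x p, Tmap P x p -> dot g p <= c) ->
  [/\ qpH P *m zpart g = 0, vle (qpA P *m zpart g) 0, qpG P *m zpart g = 0,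
      vle 0 (vpart g)
    & (qpG P)^T *m lpart g + (qpA P)^T *m vpart g = 0].
Proof.
move=> Hpsd gT; have [Hsym _] := Hpsd.
pose F0 := dot g (Fmap P 0).
(* [Tmap P] at [t x] contains [t (K x - (0, 0, y)) + F 0], so the bound [c] is affine in [t] and the
   slope cannot be positive. *)
have gK x y : vle 0 (vpart x) -> vle 0 y -> dot (vpart x) y = 0 ->
    dot g (KKT_mx P *m x) - dot (vpart g) y <= 0.
  move=> x0 y0 xy; apply: (@le0_of_affine_bound _ _ (c - F0)) => t t0.
  have tE : vpart (t *: x) = t *: vpart x by rewrite /vpart !linearZ.
  have := Tmap_intro P (t *: x) (t *: y); rewrite tE => /(_ _ _ _)/gT.
  have -> : Fmap P (t *: x) = t *: (KKT_mx P *m x) + Fmap P 0.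
    by rewrite -(subrK (Fmap P 0) (Fmap P (t *: x))) FmapB subr0 -scalemxAr.
  rewrite dotDr dotNr dotDr -/F0 => h.
  have gy : dot g (col_mx 0 (col_mx 0 (t *: y))) = t * dot (vpart g) y.
    by rewrite -{1}(vec3K g) !dot_col_mx !dot0r !add0r dotZr.
  rewrite gy in h; rewrite mulrBr lerBrDr; apply: le_trans (h _ _ _); first by rewrite dotZr; lra.
  - by move=> i; have := x0 i; rewrite !mxE; exact: mulr_ge0.
  - by move=> i; have := y0 i; rewrite !mxE; exact: mulr_ge0.
  - by rewrite !dot_linE xy !mulr0.
have vle0 k : vle 0 (0 : 'cV[R]_k) by [].
have gK3 z l v : vle 0 v ->
    dot (zpart g) (qpH P *m z + (qpG P)^T *m l + (qpA P)^T *m v)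
      - (dot (lpart g) (qpG P *m z) + dot (vpart g) (qpA P *m z)) <= 0.
  move=> v0; have := gK (col_mx z (col_mx l v)) 0.
  rewrite KKT_mulE vpartE !dot0r subr0 => /(_ v0 (vle0 _) erefl).
  by rewrite dot_vec3 !partE !dotNr opprD.
(* Each relation comes from one ray: the normal direction [y = e_i] here, then [l = G gz],
   [v = e_i], [z = gz], and finally [z = - w]. *)
have gv0 : vle 0 (vpart g).
  move=> i; rewrite [X in X <= _]mxE.
  have := gK 0 (delta_mx i 0).
  rewrite mulmx0 dot0r sub0r oppr_le0 (dot_delta (vpart g)).
  have -> : vpart (0 : 'cV[R]_(n + (m + q))) = 0 by rewrite /vpart !linear0.
  apply => //; last by rewrite dot0l.
  by move=> j; rewrite !mxE ler0n.
have Gz : qpG P *m zpart g = 0.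
  apply: dot_eq0; apply/le_anti; rewrite dot_ge0 andbT.
  have := gK3 0 (qpG P *m zpart g) 0 (vle0 _).
  by rewrite !mulmx0 add0r addr0 !dot0r addr0 subr0 dot_mulmx trmxK.
have Az : vle (qpA P *m zpart g) 0.
  move=> i; rewrite [X in _ <= X]mxE -dot_delta.
  have := gK3 0 0 (delta_mx i 0).
  rewrite !mulmx0 !add0r !dot0r addr0 subr0 dot_mulmx trmxK; apply.
  by move=> j; rewrite !mxE ler0n.
have Hz : qpH P *m zpart g = 0.
  apply: symmetric_psd_eq0 => //.
  have := gK3 (zpart g) 0 0 (vle0 _); rewrite !mulmx0 !addr0 Gz dot0r add0r.
  suff : dot (vpart g) (qpA P *m zpart g) <= 0 by lra.
  have := dot_ge0_vle (vpart g) (- (qpA P *m zpart g)) gv0.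
  rewrite dotNr oppr_ge0; apply.
  exact: vle_oppr_ge0.
split=> //; set w := _ + _.
apply: dot_eq0; apply/le_anti; rewrite dot_ge0 andbT.
have := gK3 (- w) 0 0 (vle0 _); rewrite !mulmx0 !addr0.
rewrite dot_mulmx Hsym Hz dot0l sub0r !(dot_mulmx _ _ (- w)) -dotDl -/w.
by rewrite dotNr opprK.
Qed.

(** Adding an element [w] of the cone to [x] stays in the cone, so a normal vector has nonpositive
    product with [w]; take [w = (gz, 0, 0)] and [w = (0, gl, gv)]. The linear part of [F]
    contributes [<A gz, v> <= 0] in the first case and 0 in the second. *)
Lemma Tmap_range_bounds {R : realType} {n m q : nat} (P : qp_data R n m q)
    (g x p : 'cV[R]_(n + (m + q))) :
  qpH P *m zpart g = 0 -> vle (qpA P *m zpart g) 0 -> qpG P *m zpart g = 0 ->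
  vle 0 (vpart g) -> (qpG P)^T *m lpart g + (qpA P)^T *m vpart g = 0 ->
  symmetric_psd (qpH P) -> Tmap P x p ->
  dot (zpart g) (zpart p) <= dot (qpf P) (zpart g) /\
  dot (lpart g) (lpart p) + dot (vpart g) (vpart p)
    <= dot (lpart g) (qph P) + dot (vpart g) (qpb P).
Proof.
move=> Hz Az Gz gv0 GA [Hsym _] [r [Cx xr] <-].
have zD (a b : 'cV[R]_(n + (m + q))) : zpart (a + b) = zpart a + zpart b.
  by rewrite /zpart linearD.
have lD (a b : 'cV[R]_(n + (m + q))) : lpart (a + b) = lpart a + lpart b.
  by rewrite /lpart !linearD.
have vD (a b : 'cV[R]_(n + (m + q))) : vpart (a + b) = vpart a + vpart b.
  by rewrite /vpart !linearD.
have rle w : vle 0 (vpart w) -> dot w r <= 0.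
  move=> w0; have := xr (x + w).
  rewrite opprD addrA subrr sub0r dotNl oppr_ge0; apply.
  by rewrite /coneC /= /nonneg_orthant /= vD; exact: vle_addr_ge0.
rewrite zD lD vD -{1 2 3}(vec3K x) FmapE !partE !dotDr !dotNr.
split.
- have := rle (col_mx (zpart g) (col_mx 0 0)).
  rewrite vpartE dot_vec3 !partE !dot0l !addr0.
  have := dot_ge0_vle (- (qpA P *m zpart g)) (vpart x).
  rewrite !dot_mulmx Hsym Hz !trmxK Gz !dot0l (dotC _ (qpf P)) dotNl.
  move=> h1 h2; have {}h2 := h2 (fun i => lexx _).
  suff : 0 <= - dot (qpA P *m zpart g) (vpart x) by lra.
  by apply: h1 => //; exact: vle_oppr_ge0.
- have := rle (col_mx 0 (col_mx (lpart g) (vpart g))).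
  rewrite vpartE dot_vec3 !partE dot0l add0r => /(_ gv0).
  have : dot (lpart g) (qpG P *m zpart x) + dot (vpart g) (qpA P *m zpart x) = 0.
    by rewrite !dot_mulmx -dotDl GA dot0l.
  by lra.
Qed.

(** Pairing the dual equality constraint with [dz] gives [f^T dz = - <A dz, v> >= 0]. *)
Lemma dual_infeasibility_certificate {R : realType} {n m q : nat}
    (P : qp_data R n m q) (dz : 'cV[R]_n) :
  symmetric_psd (qpH P) -> dual_infeasibility_conditions P dz ->
  dual_infeasible P.
Proof.
move=> [Hsym _] [Hz Az Gz fz]; apply/seteqP; split=> // -[[u l] v] /= [e v0].
have := congr1 (dot dz) e.
rewrite !dotDr dot0r !dot_mulmx Hsym Hz !trmxK Gz !dot0l (dotC dz) add0r addr0.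
have := dot_ge0_vle (- (qpA P *m dz)) v; rewrite dotNl => h.
suff : 0 <= - dot (qpA P *m dz) v by lra.
by apply: h => //; exact: vle_oppr_ge0.
Qed.

(** Pairing [G^T dl + A^T dv = 0] with a feasible [z] and using [<dv, b - A z> >= 0] makes the dual
    product nonnegative. *)
Lemma primal_infeasibility_certificate {R : realType} {n m q : nat}
    (P : qp_data R n m q) (dl : 'cV[R]_m) (dv : 'cV[R]_q) :
  vle 0 dv -> primal_infeasibility_conditions P dl dv -> primal_infeasible P.
Proof.
move=> dv0 [GA]; rewrite eproj_id// => hb; apply/seteqP; split=> // z /= [Gz Az].
have := congr1 (fun w => dot w z) GA; rewrite /= dot0l dotDl -!dot_mulmx Gz => e.
have := dot_ge0_vle dv (qpb P - qpA P *m z) dv0; rewrite dotDr dotNr => h.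
suff : 0 <= dot dv (qpb P) - dot dv (qpA P *m z) by lra.
by apply: h; exact: vle_subr_ge0.
Qed.

Theorem theorem5 (R : realType) (n m q : nat) (P : qp_data R n m q)
    (alpha beta eta kappa sigma : R)
    (x0 : 'cV[R]_(n + (m + q))) (x : nat -> 'cV[R]_(n + (m + q)))
    (H_psd : symmetric_psd (qpH P))
    (alpha01 : 0 < alpha < 1) (beta01 : 0 < beta < 1)
    (eta_bnd : 0 < eta < 2^-1) (kappa01 : 0 < kappa < 1)
    (sigma_gt0 : 0 < sigma)
    (no_solution : Tzeros P = set0)
    (x_fbstab : fbstab_sequence P alpha beta eta kappa sigma x0 x) :
  exists dx : 'cV[R]_(n + (m + q)),
    x k.+1 - x k @[k --> \oo] --> dx /\
    [/\ zpart dx != 0 ->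
          dual_infeasible P /\ dual_infeasibility_conditions P (zpart dx),
        (lpart dx, vpart dx) != (0, 0) ->
          primal_infeasible P /\
          primal_infeasibility_conditions P (lpart dx) (vpart dx)
      & zpart dx != 0 -> (lpart dx, vpart dx) != (0, 0) ->
          primal_infeasible P /\ dual_infeasible P].
Proof.
have [C C0 hC] := Rmap_resolvent P _ _ alpha01 sigma_gt0.
have res k : enorm (Rmap P alpha sigma (x k) (x k.+1)) <= sigma * kappa ^+ k.
  have [_ /(_ k) run] := x_fbstab.
  have /andP[d0 dk] := fbstab_delta_bounds P kappa sigma x k kappa01 sigma_gt0.
  apply: le_trans (prox_run_residual _ _ _ _ _ _ _ _ _ _ run) _.
    by rewrite mulr_ge0// ltW.
  by rewrite mulrC ler_pM2l.
have step k : exists p : 'cV[R]_(n + (m + q)) * 'cV[R]_(n + (m + q)),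
    [/\ Tmap P p.1 (sigma *: (x k + p.2 - p.1)),
        enorm p.2 <= C * sigma * kappa ^+ k
      & enorm (p.1 - x k.+1) <= C * sigma * kappa ^+ k].
  have [x' [e [Tx' he hx']]] := hC (x k) (x k.+1).
  exists (x', e); split=> //=; rewrite -mulrA.
    by apply: le_trans he _; rewrite ler_wpM2l.
  by apply: le_trans hx' _; rewrite ler_wpM2l.
have /choice[xe hxe] := step.
have [dx [xdx dxT [y [p [yp pdx]]]]] :=
  inexact_proximal_point_cvg (Tmap P) sigma kappa (C * sigma) x
    (fun j => (xe j).1) (fun j => (xe j).2) (Tmap_monotone P H_psd)
    (Tmap_resolvent P H_psd) sigma_gt0 kappa01
    (fun j => let: And3 h _ _ := hxe j in h)
    (fun j => let: And3 _ h _ := hxe j in h)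
    (fun j => let: And3 _ _ h := hxe j in h).
exists dx; split => //.
have [Hz Az Gz v0 GA] := least_norm_recession P _ dx H_psd dxT.
have bnd j := Tmap_range_bounds P dx (y j) (p j) Hz Az Gz v0 GA H_psd (yp j).
(* The values [p j] tend to [- sigma dx], so bounds valid on the range of [Tmap P] pass to that
   limit. *)
have lim_bound (g : 'cV[R]_(n + (m + q))) c :
    (forall j, dot g (p j) <= c) -> - sigma * dot g dx <= c.
  move=> gc; rewrite -dotZr; apply: (@ler_cvg_to _ \oo _ _ _ (cst c)).
  - by apply: cvg_dot pdx; exact: cvg_cst.
  - exact: cvg_cst.
  - by apply: nearW => j; exact: gc.
have fz : - sigma * dot (zpart dx) (zpart dx) <= dot (qpf P) (zpart dx).
  have := lim_bound (col_mx (zpart dx) (col_mx 0 0)) _.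
  rewrite dot_vec3 !partE !dot0l !addr0; apply => j.
  by rewrite dot_vec3 !partE !dot0l !addr0; case: (bnd j).
have hb : - sigma * (dot (lpart dx) (lpart dx) + dot (vpart dx) (vpart dx))
    <= dot (lpart dx) (qph P) + dot (vpart dx) (qpb P).
  have := lim_bound (col_mx 0 (col_mx (lpart dx) (vpart dx))) _.
  rewrite dot_vec3 !partE !dot0l !add0r; apply => j.
  by rewrite dot_vec3 !partE !dot0l !add0r; case: (bnd j).
(* The value of [F] at 0 is [(f, h, b)]. This upper bound on the sum, against the lower bounds [fz]
   and [hb], forces [f^T dz = - sigma |dz|^2] and likewise for [(dl, dv)]. *)
have fhb : dot (qpf P) (zpart dx)
    + (dot (lpart dx) (qph P) + dot (vpart dx) (qpb P))
    <= - sigma * (dot (zpart dx) (zpart dx)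
         + (dot (lpart dx) (lpart dx) + dot (vpart dx) (vpart dx))).
  have T0 : Tmap P 0 (Fmap P 0 - col_mx 0 (col_mx 0 0)).
    by apply: Tmap_intro => //; rewrite ?dot0r// /vpart !linear0.
  have := dxT _ _ T0; rewrite !col_mx0 subr0 /Fmap mulmx0 add0r /KKT_vec.
  by rewrite !dot_vec3 !partE (dotC (qpf P)).
have dual : zpart dx != 0 ->
    dual_infeasible P /\ dual_infeasibility_conditions P (zpart dx).
  move=> /dot_gt0 dz0.
  have cond : dual_infeasibility_conditions P (zpart dx).
    split=> //; have : 0 < sigma * dot (zpart dx) (zpart dx) by rewrite mulr_gt0.
    by lra.
  by split=> //; exact: dual_infeasibility_certificate cond.
have primal : (lpart dx, vpart dx) != (0, 0) ->
    primal_infeasible P /\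
    primal_infeasibility_conditions P (lpart dx) (vpart dx).
  move=> dlv0.
  have lv0 : 0 < dot (lpart dx) (lpart dx) + dot (vpart dx) (vpart dx).
    move: dlv0; rewrite xpair_eqE negb_and => /orP[] /dot_gt0 h.
      by rewrite ltr_wpDr ?dot_ge0.
    by rewrite ltr_wpDl ?dot_ge0.
  have cond : primal_infeasibility_conditions P (lpart dx) (vpart dx).
    split=> //; rewrite eproj_id//.
    have : 0 < sigma * (dot (lpart dx) (lpart dx) + dot (vpart dx) (vpart dx)).
      by rewrite mulr_gt0.
    by lra.
  by split=> //; exact: primal_infeasibility_certificate cond.
by split=> // /dual[? _] /primal[? _].
Qed.
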